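(* Let $n$ and $k$ be integers with $0 \le k \le n$, and let $P \subset \mathbb{C}^2$ be a set of $2n-k$ distinct points, of which $n$ are coloured green and $n-k$ are coloured red. Suppose that at most $\frac{2}{3}(2n-k)$ points of $P$ lie on any (complex) line. Then the number of $2$-equichromatic lines determined by $P$ that contain at most four points of $P$ is at least $\frac{1}{6}\bigl(10n - k(k+5)\bigr)$.
   Context: A line in $\mathbb{C}^2$ is said to be determined by $P$ if it contains at least two points of $P$. For an integer $r \ge 0$, a line is called $r$-equichromatic if it contains exactly $i$ green and $j$ red points of $P$ with $i + j \ge 2$ and $|i - j| \le r$. A line ''passing through at most four points'' means it contains at most four points of $P$. *)

(* Defs.v *)
From HB Require Import structures.
From mathcomp Require Import all_boot all_order all_algebra.
From mathcomp Require Import complex.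
From mathcomp Require Import boolp reals.
Set Implicit Arguments. Unset Strict Implicit. Unset Printing Implicit Defensive.
Import Order.TTheory GRing.Theory Num.Theory.
Local Open Scope ring_scope.

Section Defs.
Variable R : realType.
Local Notation C := R[i].

Definition is_line (a b : C) : bool := (a != 0) || (b != 0).
Definition on_line (a b c : C) (p : C * C) : bool := a * p.1 + b * p.2 == c.

Definition line_section (N : nat) (pts : 'I_N -> C * C) (S : {set 'I_N}) : Prop :=
  exists a b c : C, is_line a b /\ forall i, (i \in S) = on_line a b c (pts i).

Definition r_equichromatic (N : nat) (green : {set 'I_N}) (r : nat) (S : {set 'I_N}) : bool :=
  let i := #|S :&: green| in let j := #|S :\: green| in
  (2 <= i + j)%N && (`|(i%:Z - j%:Z)%R|%N <= r)%N.

(* number of 2-equichromatic lines determined by P containing at most four points of P;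
   a line determined by P is identified with the set of points of P on it (>= 2 points) *)
Definition count_2eq_small_lines (N : nat) (pts : 'I_N -> C * C) (green : {set 'I_N}) : nat :=
  #|[set S : {set 'I_N} | `[< line_section pts S >] && r_equichromatic green 2 S && (#|S| <= 4)%N]|.
End Defs.

(* Main.v *)
(** Put the points in C^3 as v_i = (x, y, 1). Since no line carries more than
    2/3 of them, the v_i can be brought, by a linear change of coordinates and
    rescaling, arbitrarily close to a unit tight frame: with
    S = sum_i x_i v_i^* v_i, the function det S ^ N / (prod x_i) ^ 3 is bounded
    below, and at a near minimum the numbers x_i v_i S^-1 v_i^* are all close
    to 3 / N. For an exact unit tight frame, sum_ij |<v_i, v_j>|^2 = N^2 / 3,
    whereas the r vectors of a line span a plane and so contribute at least
    r^2 / 2 to that sum. As each pair of points lies on exactly one line,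
    adding up over lines gives sum_l (4 r_l - r_l^2) >= 4 N, an inequality of
    Langer and Bojanowski usually deduced from the
    Bogomolov-Miyaoka-Yau inequality.
    Counting pairs with signs, where d_l is the number of green minus the
    number of red points on l, gives sum_l (r_l - d_l^2) = N - k^2; hence
    sum_l (5 r_l - r_l^2 - d_l^2) >= 5 N - k^2, and a summand is at most 6, and
    at most 0 unless l is one of the lines being counted. *)
Require Import Defs.
From HB Require Import structures.
From mathcomp Require Import all_boot all_order all_algebra.
From mathcomp Require Import complex.
From mathcomp Require Import boolp reals.
From mathcomp Require Import ring lra zify.
Set Implicit Arguments.
Unset Strict Implicit.
Unset Printing Implicit Defensive.
Import Order.TTheory GRing.Theory Num.Theory.
Local Open Scope ring_scope.

(** * Determinants and positive definite Hermitian matrices *)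

Lemma det_rank1_update (F : comUnitRingType) d (S : 'M[F]_d) (u : 'cV[F]_d)
    (w : 'rV[F]_d) :
  S \in unitmx ->
  \det (S + u *m w) = \det S * (1 + (w *m invmx S *m u) 0 0).
Proof.
move=> Su.
(* The bordered matrix is factored once through [S] and once through [S + u *m w]; comparing
   determinants gives the formula. *)
have e1 : block_mx S (- u) w 1%:M =
    block_mx S 0 w (1%:M + w *m invmx S *m u) *m
    block_mx 1%:M (- (invmx S *m u)) 0 (1%:M : 'M_1).
  rewrite mulmx_block !mulmx1 !mulmx0 !addr0 !mulmxN !mulmxA mulmxV //.
  by rewrite mul1mx addrCA addNr addr0.
have e2 : block_mx S (- u) w 1%:M =
    block_mx 1%:M (- u) 0 1%:M *m block_mx (S + u *m w) 0 w (1%:M : 'M_1).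
  by rewrite mulmx_block !mulmx1 !mul1mx !mul0mx mulNmx addrK !add0r.
have := congr1 determinant e1; rewrite {1}e2 !det_mulmx !det_lblock !det_ublock.
rewrite !det1 !mulr1 !mul1r => ->; congr (_ * _).
by rewrite det_mx11 !mxE eqxx.
Qed.

Section Hermitian.
Local Open Scope sesquilinear_scope.
Variable C : numClosedFieldType.

Lemma adjmxM m n p (A : 'M[C]_(m, n)) (B : 'M[C]_(n, p)) :
  (A *m B)^t* = B^t* *m A^t*.
Proof. by rewrite trmx_mul map_mxM. Qed.

Lemma adjmxE m n (A : 'M[C]_(m, n)) i j : A^t* i j = (A j i)^*.
Proof. by rewrite !mxE. Qed.

Lemma adjmxD m n (A B : 'M[C]_(m, n)) : (A + B)^t* = A^t* + B^t*.
Proof. by rewrite linearD /= map_mxD. Qed.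

Lemma adjmxZ m n (a : C) (A : 'M[C]_(m, n)) : (a *: A)^t* = a^* *: A^t*.
Proof. by rewrite linearZ /= map_mxZ. Qed.

Variable d : nat.

Lemma rank1_form (u v : 'rV[C]_d) :
  (u *m (v^t* *m v) *m u^t*) 0 0 = `|(v *m u^t*) 0 0| ^+ 2.
Proof.
have -> : u *m (v^t* *m v) *m u^t* = (v *m u^t*)^t* *m (v *m u^t*).
  by rewrite adjmxM trmxCK !mulmxA.
by rewrite mxE big_ord1 adjmxE normCKC.
Qed.

(** Strictness is carried by the determinant: a semidefinite Hermitian matrix is definite exactly
    when it is nonsingular, and rank-one updates preserve this form directly. *)
Definition posdef (S : 'M[C]_d) : Prop :=
  [/\ S^t* = S, forall u : 'rV_d, 0 <= (u *m S *m u^t*) 0 0 & 0 < \det S].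

Lemma posdef_unit S : posdef S -> S \in unitmx.
Proof. by case=> _ _ dS; rewrite unitmxE unitfE gt_eqF. Qed.

Lemma posdef_inv S : posdef S -> posdef (invmx S).
Proof.
move=> pS; have Su := posdef_unit pS; case: pS => [hS pS dS].
have hT : (invmx S)^t* = invmx S by rewrite trmx_inv map_invmx hS.
split=> // [u|]; last by rewrite det_inv invr_gt0.
have := pS (u *m invmx S).
by rewrite adjmxM hT !mulmxA mulmxKV.
Qed.

Lemma posdef_rank1 S (x : C) (v : 'rV[C]_d) : 0 <= x -> posdef S ->
  posdef (S + x *: (v^t* *m v)) /\ \det S <= \det (S + x *: (v^t* *m v)).
Proof.
move=> x0 pS; have Su := posdef_unit pS.
have [hT pT _] := posdef_inv pS; case: pS => [hS pS dS].
have dE : \det S <= \det (S + x *: (v^t* *m v)).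
  rewrite scalemxAl det_rank1_update // -scalemxAr mxE.
  by rewrite ler_peMr ?(ltW dS) // lerDl mulr_ge0.
split=> //; split; last exact: lt_le_trans dE.
  by rewrite adjmxD hS adjmxZ adjmxM trmxCK geC0_conj.
move=> u; rewrite mulmxDr mulmxDl mxE addr_ge0 // -scalemxAr -scalemxAl mxE.
by rewrite rank1_form mulr_ge0 // exprn_ge0.
Qed.

Lemma posdef_sum (I : eqType) (r : seq I) (P : pred I) (x : I -> C)
    (v : I -> 'rV[C]_d) (S : 'M[C]_d) :
  (forall i, 0 <= x i) -> posdef S ->
  posdef (S + \sum_(i <- r | P i) x i *: ((v i)^t* *m v i)) /\
  \det S <= \det (S + \sum_(i <- r | P i) x i *: ((v i)^t* *m v i)).
Proof.
move=> x0 pS; elim: r => [|i r [IH1 IH2]]; first by rewrite big_nil addr0.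
rewrite big_cons; case: ifP => // _; rewrite addrCA addrC.
have [p1 p2] := posdef_rank1 (v i) (x0 i) IH1.
by split=> //; apply: le_trans p2.
Qed.

(** * Weighted Gram matrices and trace identities *)

Variables (I : finType) (v : I -> 'rV[C]_d).

Definition wgram (A : {set I}) (x : I -> C) : 'M[C]_d :=
  \sum_(i in A) x i *: ((v i)^t* *m v i).

(** One Cauchy-Binet term bounds the determinant: the chosen vectors alone give [V^t* *m D *m V],
    and each further rank-one term can only raise it. *)
Lemma wgram_det_ge (x : I -> C) (f : 'I_d -> I) :
  (forall i, 0 < x i) -> injective f ->
  \det (\matrix_k v (f k)) != 0 ->
  posdef (wgram setT x) /\
  `|\det (\matrix_k v (f k))| ^+ 2 * \prod_k x (f k) <= \det (wgram setT x).
Proof.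
move=> x0 fi; set V := \matrix_k _ => dV.
pose D : 'M[C]_d := diag_mx (\row_k x (f k)).
pose S := V^t* *m D *m V.
have SE : S = \sum_k x (f k) *: ((v (f k))^t* *m v (f k)).
  apply/matrixP => a b; rewrite /S mul_mx_diag summxE mxE; apply: eq_bigr => k _.
  rewrite !mxE big_ord1 !mxE; ring.
have dS : \det S = `|\det V| ^+ 2 * \prod_k x (f k).
  rewrite !det_mulmx det_diag det_map_mx det_tr normCKC mulrAC.
  by congr (_ * _); apply: eq_bigr => k _; rewrite mxE.
have pS : posdef S.
  split; last first.
  - by rewrite dS mulr_gt0 ?exprn_gt0 ?normr_gt0 // prodr_gt0.
  - move=> u; rewrite SE mulmx_sumr mulmx_suml summxE sumr_ge0 // => k _.
    by rewrite -scalemxAr -scalemxAl mxE rank1_form mulr_ge0 ?exprn_ge0 // ltW.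
  - rewrite !adjmxM trmxCK mulmxA; congr (_ *m _ *m _).
    apply/matrixP => a b; rewrite adjmxE !mxE eq_sym.
    by case: eqP => [->|_]; rewrite ?mulr1n ?mulr0n ?conjC0 // geC0_conj // ltW.
have -> : wgram setT x = S + \sum_(i | i \notin f @: setT) x i *: ((v i)^t* *m v i).
  rewrite /wgram (bigID (mem (f @: setT))) /= SE; congr (_ + _).
  - rewrite (eq_bigl (mem (f @: setT))); last by move=> i; rewrite inE.
    rewrite big_imset /=; last by move=> ? ? _ _; apply: fi.
    by apply: eq_bigl => k; rewrite inE.
  - by apply: eq_bigl => i; rewrite inE.
by rewrite -dS; apply: posdef_sum => // i; apply: ltW.
Qed.

Variable x : I -> C.
Hypothesis x_gt0 : forall i, 0 < x i.
Hypothesis wgram_pos : posdef (wgram setT x).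
Let S := wgram setT x.
Let T := invmx S.

(** Inner products for the form [T]. In it, the [v i] scaled by the square roots of [x i] form a
    Parseval frame, with squared lengths [x i * wform i i]. *)
Definition wform i j : C := (v i *m T *m (v j)^t*) 0 0.

Lemma wform_conj i j : wform j i = (wform i j)^*.
Proof.
have [hT _ _] := posdef_inv wgram_pos.
by rewrite /wform -adjmxE !adjmxM trmxCK hT mulmxA.
Qed.

Lemma wform_ge0 i : 0 <= wform i i.
Proof. by have [_ pT _] := posdef_inv wgram_pos; apply: pT. Qed.

Lemma mxtrace_wgram A : \tr (wgram A x *m T) = \sum_(i in A) x i * wform i i.
Proof.
rewrite mulmx_suml linear_sum; apply: eq_bigr => i _.
by rewrite -scalemxAl linearZ /= -mulmxA mxtrace_mulC trace_mx11.
Qed.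

Lemma mxtrace_wgram_sq A :
  \tr (wgram A x *m T *m (wgram A x *m T)) =
  \sum_(i in A) \sum_(j in A) x i * x j * `|wform i j| ^+ 2.
Proof.
rewrite /wgram !mulmx_suml linear_sum; apply: eq_bigr => i _ /=.
rewrite mulmx_sumr linear_sum; apply: eq_bigr => j _ /=.
rewrite -!scalemxAl -!scalemxAr !linearZ /= mulrA; congr (_ * _).
have -> : (v i)^t* *m v i *m T *m ((v j)^t* *m v j *m T) =
    (v i)^t* *m ((v i *m T *m (v j)^t*) *m (v j *m T)) by rewrite !mulmxA.
rewrite mxtrace_mulC -(mulmxA (v i *m T *m _)) trace_mx11 mxE big_ord1 normCK.
by rewrite -wform_conj.
Qed.

Lemma sum_wform_sq :
  \sum_i \sum_j x i * x j * `|wform i j| ^+ 2 = d%:R.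
Proof.
have := mxtrace_wgram_sq setT.
rewrite mulmxV ?posdef_unit // mul1mx mxtrace1 => ->.
by apply: eq_big => [i|i _]; rewrite ?inE //; apply: eq_bigl => j; rewrite inE.
Qed.

(** [H *m T] is similar to a Hermitian matrix. To avoid a square root of [T], the last [T] is
    written as [T *m S *m T] and [S] is expanded: each term is [x k] times the [T]-form at
    [v k *m T *m H]. *)
Lemma mxtrace_sq_ge0 H : H^t* = H -> 0 <= \tr (H *m T *m (H *m T)).
Proof.
move=> hH; have [hT pT _] := posdef_inv wgram_pos.
have -> : H *m T *m (H *m T) = H *m T *m H *m (T *m S *m T).
  by rewrite mulVmx ?posdef_unit // mul1mx !mulmxA.
rewrite {1}/S /wgram mulmx_sumr !mulmx_suml mulmx_sumr linear_sum sumr_ge0 //= => k _.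
rewrite -!scalemxAr -scalemxAl -scalemxAr linearZ /= mulr_ge0 ?(ltW (x_gt0 _)) //.
have -> : H *m T *m H *m (T *m ((v k)^t* *m v k) *m T) =
    (H *m T *m H *m T *m (v k)^t*) *m (v k *m T) by rewrite !mulmxA.
rewrite mxtrace_mulC trace_mx11.
have := pT (v k *m T *m H).
by rewrite !adjmxM hH hT !mulmxA.
Qed.

(* The eigenvalues of [wgram A x *m T] are real and, as its image lies in the
   kernel of [w], at most [d.-1] of them are nonzero: this is Cauchy-Schwarz,
   seen as nonnegativity of the trace of the square of its deviation from a
   multiple of the T-orthogonal projection [Q] onto that kernel. *)
Lemma hyperplane_trace (A : {set I}) (w : 'cV[C]_d) k :
  (1 < d)%N -> (forall i, i \in A -> v i *m w = 0) -> v k *m w != 0 ->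
  (\sum_(i in A) x i * wform i i) ^+ 2 <=
  d.-1%:R * \sum_(i in A) \sum_(j in A) x i * x j * `|wform i j| ^+ 2.
Proof.
move=> d1 Aw kw; have Su := posdef_unit wgram_pos.
rewrite -mxtrace_wgram -mxtrace_wgram_sq; set B := wgram A x *m T.
have [hS _ _] := wgram_pos.
pose y := S *m w; pose rho := (w^t* *m y) 0 0.
have rho_gt0 : 0 < rho.
  have rhoE : rho = \sum_i x i * `|(v i *m w) 0 0| ^+ 2.
    rewrite /rho /y /S /wgram mulmx_suml mulmx_sumr summxE.
    apply: eq_big => [i|i _]; first by rewrite inE.
    rewrite -scalemxAl -scalemxAr mxE; congr (_ * _).
    by have := rank1_form (w^t*) (v i); rewrite trmxCK => <-; rewrite !mulmxA.
  rewrite rhoE (bigD1 k) //= ltr_pwDl //.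
    rewrite mulr_gt0 // exprn_gt0 // normr_gt0; apply: contraNneq kw => vw.
    by apply/eqP/matrixP => a b; rewrite !ord1 vw mxE.
  by apply: sumr_ge0 => i _; rewrite mulr_ge0 ?exprn_ge0 // ltW.
pose P := rho^-1 *: (y *m w^t*); pose Q := 1%:M - P.
have rho0 : rho != 0 by rewrite gt_eqF.
have wy : w^t* *m y = rho%:M by apply/matrixP => a b; rewrite !ord1 [RHS]mxE mulr1n.
have PP : P *m P = P.
  rewrite /P -scalemxAl -scalemxAr mulmxA -(mulmxA y) wy mul_mx_scalar.
  by rewrite -scalemxAl (scalerA rho^-1 rho) mulVf // scale1r.
have QQ : Q *m Q = Q.
  by rewrite /Q mulmxBr mulmx1 mulmxBl mul1mx PP subrr subr0.
have trQ : \tr Q = d.-1%:R.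
  rewrite /Q linearB /= mxtrace1 /P linearZ /= mxtrace_mulC wy.
  by rewrite mxtrace_scalar mulVf // -subn1 natrB // ltnW.
have BQ : B *m Q = B.
  rewrite /Q mulmxBr mulmx1 /P -scalemxAr mulmxA.
  suff -> : B *m y = 0 by rewrite mul0mx scaler0 subr0.
  rewrite /B /y -mulmxA mulKmx // /wgram mulmx_suml big1 // => i iA.
  by rewrite -scalemxAl -mulmxA Aw // mulmx0 scaler0.
(* The Hermitian matrix behind [Q]: it lets [mxtrace_sq_ge0] apply to the deviation [B - t *: Q]. *)
pose K := S - rho^-1 *: (y *m y^t*).
have KT : K *m T = Q.
  rewrite /K mulmxBl mulmxV // -scalemxAl -mulmxA /y adjmxM hS.
  by rewrite -(mulmxA (w^t*)) mulmxV // mulmx1.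
have hA : (wgram A x)^t* = wgram A x.
  rewrite /wgram; elim/big_rec: _ => [|i M _ IH]; first by rewrite trmx0 map_mx0.
  by rewrite adjmxD IH adjmxZ adjmxM trmxCK geC0_conj // ltW.
have hK : K^t* = K.
  rewrite /K -scaleN1r adjmxD hS !adjmxZ adjmxM trmxCK rmorphN1.
  by rewrite geC0_conj // invr_ge0 ltW.
have [d0 d0'] : (0 : C) < d.-1%:R /\ (d.-1%:R : C) != 0.
  by rewrite pnatr_eq0 ltr0n; case: (d) d1 => [|[]].
(* The value of [t] that minimises the trace of the square of [B - t *: Q], since [Q] has trace
   [d.-1]. *)
pose t := \tr B / d.-1%:R.
have rB : (\tr B)^* = \tr B.
  rewrite /B mxtrace_wgram geC0_conj //; apply: sumr_ge0 => i _.
  by rewrite mulr_ge0 ?wform_ge0 // ltW.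
have rt : t^* = t by rewrite /t rmorphM /= rB fmorphV rmorph_nat.
have hH : (wgram A x - t *: K)^t* = wgram A x - t *: K.
  by rewrite -scaleN1r adjmxD hA !adjmxZ hK rt rmorphN1.
clearbody Q; have := mxtrace_sq_ge0 hH; rewrite mulmxBl -scalemxAl KT -/B.
have -> : \tr ((B - t *: Q) *m (B - t *: Q)) =
    \tr (B *m B) - (\tr B) ^+ 2 / d.-1%:R.
  rewrite mulmxBr !mulmxBl -!scalemxAl -!scalemxAr BQ QQ !linearB /= !linearZ /=.
  rewrite (mxtrace_mulC Q) BQ trQ /t; field; exact: d0'.
by rewrite subr_ge0 ler_pdivrMr // mulrC.
Qed.

End Hermitian.

(** * Near-minimisers and small logarithmic gradients *)

Lemma bernoulli_ge (R : realFieldType) (h : R) n :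
  -1 <= h -> 1 + n%:R * h <= (1 + h) ^+ n.
Proof.
move=> h1; elim: n => [|n IH]; first by rewrite mul0r addr0.
rewrite exprS; apply: (@le_trans _ _ ((1 + h) * (1 + n%:R * h))).
  rewrite -natr1 -subr_ge0.
  have -> : (1 + h) * (1 + n%:R * h) - (1 + (n%:R + 1) * h) = n%:R * h ^+ 2 by ring.
  by rewrite mulr_ge0 ?sqr_ge0.
by rewrite ler_wpM2l // -lerBlDl sub0r.
Qed.

Lemma expr1D_le (R : realFieldType) (y : R) n :
  -1 <= y <= 1 -> (1 + y) ^+ n <= 1 + n%:R * y + 4 ^+ n * y ^+ 2.
Proof.
move=> /andP[y1 y2]; elim: n => [|n IH].
  by rewrite expr0 mul0r addr0 mul1r lerDl sqr_ge0.
rewrite exprS; apply: (@le_trans _ _ ((1 + y) * (1 + n%:R * y + 4 ^+ n * y ^+ 2))).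
  by rewrite ler_wpM2l // -lerBlDl sub0r.
have n4 : (n%:R : R) <= 4 ^+ n.
  by rewrite -natrX ler_nat ltnW // ltn_expl.
rewrite -subr_ge0 -natr1 [4 ^+ n.+1]exprS.
have -> : 1 + (n%:R + 1) * y + 4 * 4 ^+ n * y ^+ 2 -
    (1 + y) * (1 + n%:R * y + 4 ^+ n * y ^+ 2) =
    y ^+ 2 * (2 * 4 ^+ n - n%:R + 4 ^+ n * (1 - y)) by ring.
have K0 : (0 : R) <= 4 ^+ n by rewrite exprn_ge0.
rewrite mulr_ge0 ?sqr_ge0 // addr_ge0 ?mulr_ge0 ?subr_ge0 //.
by lra.
Qed.

(* [tau] is the logarithmic gradient of [p]. The bounded-below function
   [p ^+ #|I| / (\prod_i x i) ^+ d] is nearly minimal somewhere, and there its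
   logarithmic gradient is small; no exact minimiser need exist. *)
Lemma near_critical (R : realType) (I : finType) (d : nat) (c : R)
    (p : (I -> R) -> R) (tau : (I -> R) -> I -> R) :
  0 < c ->
  (forall x : I -> R, (forall i, 0 < x i) -> 0 < p x) ->
  (forall x : I -> R, (forall i, 0 < x i) -> c * (\prod_i x i) ^+ d <= p x ^+ #|I|) ->
  (forall (x : I -> R) i, (forall i, 0 < x i) -> 0 <= tau x i) ->
  (forall (x : I -> R) i (h : R), (forall i, 0 < x i) -> -1 < h ->
     p (fun j => if j == i then (1 + h) * x j else x j) =
     p x * (1 + h * tau x i)) ->
  forall e : R, 0 < e -> exists x : I -> R, (forall i, 0 < x i) /\
    forall i, `|#|I|%:R * tau x i - d%:R| <= e.
Proof.
move=> c0 p0 pc t0 pS e e0; set N := #|I|.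
have scale_gt0 (x : I -> R) i (h : R) : (forall i, 0 < x i) -> -1 < h ->
    forall j, 0 < (if j == i then (1 + h) * x j else x j).
  by move=> x0 h1 j; case: ifP => // _; rewrite mulr_gt0 // -ltrBlDl sub0r.
have t1 (x : I -> R) i : (forall i, 0 < x i) -> tau x i <= 1.
  move=> x0; rewrite leNgt; apply/negP => t1.
  (* Were [tau x i] above 1, this admissible step would make [p] vanish. *)
  have h1 : -1 < - (tau x i)^-1 by rewrite ltrN2 invf_lt1 // (lt_trans ltr01).
  have := p0 _ (scale_gt0 x i _ x0 h1); rewrite pS //.
  by rewrite mulNr mulVf ?subrr ?mulr0 ?ltxx // gt_eqF // (lt_trans ltr01).
pose f (x : I -> R) := p x ^+ N / (\prod_i x i) ^+ d.
have prod_gt0 (x : I -> R) : (forall i, 0 < x i) -> 0 < (\prod_i x i) ^+ d.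
  by move=> x0; rewrite exprn_gt0 // prodr_gt0.
pose E : classical_sets.set R := fun y => exists2 x : I -> R, (forall i, 0 < x i) & y = f x.
have Ec : classical_sets.lbound E c.
  by move=> _ [x x0 ->]; rewrite /f ler_pdivlMr ?prod_gt0 // pc.
have En : classical_sets.nonempty E by exists (f (fun=> 1)), (fun=> 1).
have Einf : classical_sets.has_inf E by split=> //; exists c.
set m := inf E.
have m0 : 0 < m by apply: lt_le_trans c0 _; apply: lb_le_inf.
(* [eta ^+ 2 * L] collects the second-order errors: [4 ^+ N] from [expr1D_le], and [1 + N + 4 ^+ N]
   bounding the power that multiplies the slack of the near-minimum. *)
pose L : R := 1 + N%:R + 2 * 4 ^+ N.
have L0 : 0 < L.
  by rewrite /L ltr_wpDr ?mulr_ge0 ?exprn_ge0 // ltr_wpDr.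
pose eta := Num.min 2^-1 (e / L).
have eta0 : 0 < eta by rewrite lt_min invr_gt0 ltr0n divr_gt0.
have eta1 : eta < 1.
  by rewrite gt_min invf_lt1 ?ltr1n ?ltr0n.
have etaL : eta * L <= e by rewrite -ler_pdivlMr // ge_min lexx orbT.
(* The slack is quadratic in the step [eta], so it cannot hide a first-order decrease. *)
have [_ [x x0 ->] fx] : exists2 y, E y & y < m + m * eta ^+ 2.
  by apply: inf_adherent => //; rewrite mulr_gt0 // exprn_gt0.
exists x; split=> // i; set t := tau x i.
(* Rescaling [x i] by [1 + h] cannot bring [f] below [m]. Taking [h] to be [eta] and [- eta] bounds
   the gradient on both sides. *)
have key (h : R) : -1 < h -> h ^+ 2 = eta ^+ 2 -> (d%:R - N%:R * t) * h <= eta ^+ 2 * L.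
  move=> h1 h2.
  have h3 : h ^+ 2 < 1 by rewrite h2 expr_lt1 // ltW.
  have t01 : 0 <= t <= 1 by rewrite t0 // t1.
  have hle1 : h <= 1.
    rewrite leNgt; apply/negP => h4.
    by have := ltr_pM2l (lt_trans ltr01 h4) 1 h; rewrite h4 mulr1; nra.
  have fm : (1 + h) ^+ d * m <= f x * (1 + h * t) ^+ N.
    have prodE : \prod_j (if j == i then (1 + h) * x j else x j) =
        (1 + h) * \prod_j x j.
      rewrite (bigD1 i) //= eqxx [in RHS](bigD1 i) //= mulrA; congr (_ * _).
      by apply: eq_bigr => j /negPf ->.
    have := ge_inf (ex_intro _ c Ec)
      (ex_intro2 _ _ _ (scale_gt0 x i h x0 h1) erefl : E _).
    rewrite -/m {1}/f pS // -/t prodE !exprMn.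
    rewrite [(1 + h) ^+ d * (\prod_j _) ^+ d]mulrC invfM mulrACA mulrA.
    by rewrite ler_pdivlMr ?exprn_gt0 //; [rewrite mulrC mulrAC | lra].
  have lo := bernoulli_ge d (ltW h1).
  have up : (1 + h * t) ^+ N <= 1 + N%:R * (h * t) + 4 ^+ N * (h * t) ^+ 2.
    by apply: expr1D_le; apply/andP; split; nra.
  have q0 : 0 <= (1 + h * t) ^+ N by rewrite exprn_ge0 //; nra.
  have {fm} : m * (1 + d%:R * h) <= m * ((1 + eta ^+ 2) * (1 + h * t) ^+ N).
    rewrite (le_trans _ (le_trans fm _)) //.
      by rewrite [leRHS]mulrC ler_pM2l.
    rewrite mulrA ler_wpM2r //; apply: le_trans (ltW fx) _.
    by rewrite mulrDr mulr1.
  rewrite ler_pM2l // => bd.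
  have K0 : (0 : R) <= 4 ^+ N by rewrite exprn_ge0.
  have N0 : (0 : R) <= N%:R by [].
  rewrite /L; move: (4 ^+ N) (N%:R) K0 N0 up => K n K0 N0 up.
  set q := (1 + h * t) ^+ N in up q0 bd *.
  have a1 : (h * t) ^+ 2 <= eta ^+ 2.
    by rewrite exprMn h2 ler_piMr ?sqr_ge0 // expr_le1 //; case/andP: t01.
  have a2 : K * (h * t) ^+ 2 <= K * eta ^+ 2 by rewrite ler_wpM2l.
  have a3 : n * (h * t) <= n by rewrite ler_piMr //; nra.
  have a4 : K * eta ^+ 2 <= K by rewrite ler_piMr // -h2 ltW.
  have a5 : q <= 1 + n + K by lra.
  have e2 : 0 <= eta ^+ 2 by rewrite sqr_ge0.
  have := ler_wpM2l e2 a5; nra.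
rewrite ler_norml; apply/andP; split.
  have := key eta; rewrite (lt_trans _ eta0) ?ltrN10 // => /(_ isT erefl).
  by rewrite expr2 -mulrA mulrC ler_pM2l //; lra.
have := key (- eta); rewrite ltrN2 eta1 sqrrN => /(_ isT erefl).
by rewrite mulrN -mulNr expr2 -mulrA mulrC ler_pM2l //; lra.
Qed.

(** * Lines in C^2 and homogeneous coordinates *)

Section Lines.
Variable R : realType.
Local Notation C := R[i].

Lemma line_through (p q : C * C) :
  exists a b c : C, [/\ is_line a b, on_line a b c p & on_line a b c q].
Proof.
have [->|] := eqVneq p q.
  (* Coincident points get a vertical line; [three_points] relies on this case. *)
  exists 1, 0, q.1; rewrite /on_line mul1r mul0r addr0 eqxx; split=> //.
  by rewrite /is_line oner_eq0.
case: p q => [p1 p2] [q1 q2] pq.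
exists (p2 - q2), (q1 - p1), ((p2 - q2) * p1 + (q1 - p1) * p2).
rewrite /is_line /on_line /= eqxx; split=> //; last by apply/eqP; ring.
move: pq; rewrite xpair_eqE negb_and orbC !subr_eq0.
by rewrite [q1 == _]eq_sym.
Qed.

Lemma line_unique (a b c a' b' c' : C) (p q z : C * C) :
  p != q -> is_line a b -> is_line a' b' ->
  on_line a b c p -> on_line a b c q -> on_line a' b' c' p ->
  on_line a' b' c' q -> on_line a b c z = on_line a' b' c' z.
Proof.
wlog suff : a b c a' b' c' / p != q -> is_line a b -> is_line a' b' ->
    on_line a b c p -> on_line a b c q -> on_line a' b' c' p ->
    on_line a' b' c' q -> on_line a b c z -> on_line a' b' c' z.
  move=> H pq l l' h1 h2 h3 h4; apply/idP/idP.
    exact: (H a b c a' b' c').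
  exact: (H a' b' c' a b c).
case: p q z => [p1 p2] [q1 q2] [z1 z2].
rewrite xpair_eqE negb_and /is_line /on_line /= => pq l l'.
move=> /eqP hp /eqP hq /eqP hp' /eqP hq' /eqP hz.
(* Both coefficient vectors annihilate the nonzero vector [p - q], hence are proportional. *)
have cross : a * b' = a' * b.
  have e : a * (p1 - q1) + b * (p2 - q2) = 0.
    by rewrite !mulrBr -[0](subrr c) -{1}hp -hq; ring.
  have e' : a' * (p1 - q1) + b' * (p2 - q2) = 0.
    by rewrite !mulrBr -[0](subrr c') -{1}hp' -hq'; ring.
  apply/eqP; rewrite -subr_eq0; case/orP: pq; rewrite -subr_eq0 => ne.
    apply/eqP; apply: (mulfI ne); rewrite mulr0.
    transitivity ((a * (p1 - q1) + b * (p2 - q2)) * b' -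
      (a' * (p1 - q1) + b' * (p2 - q2)) * b); first by ring.
    by rewrite e e' !mul0r subrr.
  apply/eqP; apply: (mulfI ne); rewrite mulr0.
  transitivity ((a' * (p1 - q1) + b' * (p2 - q2)) * a -
      (a * (p1 - q1) + b * (p2 - q2)) * a'); first by ring.
  by rewrite e e' !mul0r subrr.
have ez : a * (z1 - p1) + b * (z2 - p2) = 0.
  by rewrite !mulrBr -[0](subrr c) -{1}hz -hp; ring.
rewrite -hp' -subr_eq0; apply/eqP; case/orP: l => ne; apply: (mulfI ne).
  transitivity (a' * (a * (z1 - p1) + b * (z2 - p2)) +
    (a * b' - a' * b) * (z2 - p2)); first by ring.
  by rewrite ez cross subrr mul0r !mulr0 addr0.
transitivity (b' * (a * (z1 - p1) + b * (z2 - p2)) -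
    (a * b' - a' * b) * (z1 - p1)); first by ring.
by rewrite ez cross subrr mul0r !mulr0 subr0.
Qed.

Definition homog (p : C * C) : 'rV[C]_3 := \row_k [:: p.1; p.2; 1]`_k.

Lemma homog_mul (p : C * C) (w : 'cV[C]_3) :
  (homog p *m w) 0 0 = w 0 0 * p.1 + w 1 0 * p.2 + w 2%:R 0.
Proof.
have -> : 2%:R = lift ord0 (lift ord0 ord0) :> 'I_3 by apply/val_inj.
have -> : 1 = lift ord0 ord0 :> 'I_3 by apply/val_inj.
by rewrite !mxE !big_ord_recl big_ord0 !mxE /=; ring.
Qed.

(** A kernel vector is the equation of a common line; if its first two entries vanish, the last
    coordinate 1 of the points kills the third. *)
Lemma homog_det_neq0 (p : 'I_3 -> C * C) :
  (forall a b c, is_line a b -> exists k, ~~ on_line a b c (p k)) ->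
  \det (\matrix_k homog (p k)) != 0.
Proof.
move=> nc; rewrite -det_tr; apply/negP => /det0P[u u0 uV].
have pu k : homog (p k) *m u^T = 0.
  have : (\matrix_k homog (p k)) *m u^T = 0 by rewrite -[LHS]trmxK trmx_mul trmxK uV trmx0.
  by move/(congr1 (row k)); rewrite row_mul rowK row0.
have uE k : u 0 0 * (p k).1 + u 0 1 * (p k).2 + u 0 2%:R = 0.
  by have := homog_mul (p k) u^T; rewrite pu !mxE.
have [l|] := boolP (is_line (u 0 0) (u 0 1)).
  have [k /negP[]] := nc _ _ (- u 0 2%:R) l.
  by rewrite /on_line -addr_eq0 uE.
rewrite negb_or !negbK => /andP[/eqP z0 /eqP z1]; case/negP: u0.
have := uE 0; rewrite z0 z1 !mul0r !add0r => z2.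
apply/eqP/matrixP => i k; rewrite ord1 mxE.
case: k => [[|[|[|//]]] kl].
- by rewrite -[RHS]z0; congr (u _ _); apply/val_inj.
- by rewrite -[RHS]z1; congr (u _ _); apply/val_inj.
- by rewrite -[RHS]z2; congr (u _ _); apply/val_inj.
Qed.

End Lines.

(** * Nearly tight frames from the 2/3 condition *)

Lemma prod_le_top3 (R : realType) (I : finType) (A : {set I}) (x : I -> R) a b c :
  (forall i, 0 < x i) -> (3 <= #|I|)%N -> (3 * #|A| <= 2 * #|I|)%N ->
  a \in A -> b \in A -> b != a -> 
  (forall i, x i <= x a) -> (forall i, i != a -> x i <= x b) ->
  c \notin A -> (forall i, i \notin A -> x i <= x c) ->
  (\prod_i x i) ^+ 3 <= (x a * x b * x c) ^+ #|I|.
Proof.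
move=> x0 I3 A23 aA bA ba xa xb cA xc.
have xge0 i : 0 <= x i by apply: ltW.
have xcb : x c <= x b by apply: xb; apply: contraNneq cA => ->.
have A2 : (2 <= #|A|)%N.
  by rewrite (cardsD1 a) aA (cardsD1 b) !inE ba bA.
have AI : (#|A| <= #|I|)%N by rewrite max_card.
have le1 : \prod_i x i <= x a * x b ^+ #|A|.-1 * x c ^+ (#|I| - #|A|).
  rewrite (bigID (mem A)) /= (bigD1 a) //=; apply: ler_pM.
  - by rewrite mulr_ge0 // prodr_ge0.
  - by rewrite prodr_ge0.
  - rewrite ler_pM2l //; apply: (@le_trans _ _ (\prod_(i in A | i != a) x b)).
      apply: ler_prod; move=> i /andP[_ ia]; apply/andP; split; [apply: xge0 | exact: xb].
    rewrite (eq_bigl (mem (A :\ a))) => [|i]; last by rewrite !inE andbC.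
    by rewrite prodr_const (cardsD1 a A) aA.
  - apply: (@le_trans _ _ (\prod_(i | i \notin A) x c)).
      apply: ler_prod; move=> i iA; apply/andP; split; [apply: xge0 | exact: xc].
    rewrite (eq_bigl (mem (~: A))) => [|i]; last by rewrite !inE.
    by rewrite prodr_const cardsCs setCK.
apply: le_trans (lerXn2r _ _ _ le1) _; rewrite ?nnegrE ?prodr_ge0 //.
  by rewrite !mulr_ge0 ?exprn_ge0.
rewrite !exprMn -!exprM.
(* After cubing, [x c] has exponent [#|I| + q]; that [q] is a natural number is the 2/3 bound. The
   surplus [q] moves to [x b], and then [#|I| - 3] factors [x b] move to [x a]. *)
have [q qE] : exists q, (#|A|.-1 * 3 + q = 2 * #|I| - 3)%N.
  by exists (2 * #|I| - 3 - #|A|.-1 * 3)%N; lia.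
have -> : ((#|I| - #|A|) * 3 = #|I| + q)%N by lia.
rewrite exprD mulrA [_ * x c ^+ #|I| * _]mulrAC ler_wpM2r ?exprn_ge0 //.
apply: (@le_trans _ _ (x a ^+ 3 * x b ^+ (#|A|.-1 * 3) * x b ^+ q)).
  by rewrite ler_wpM2l ?mulr_ge0 ?exprn_ge0 // lerXn2r // nnegrE.
rewrite -mulrA -exprD qE (_ : (2 * #|I| - 3 = (#|I| - 3) + #|I|)%N); last by lia.
rewrite exprD mulrA ler_wpM2r ?exprn_ge0 //.
have -> : x a ^+ #|I| = x a ^+ 3 * x a ^+ (#|I| - 3) by rewrite -exprD subnKC.
by rewrite ler_wpM2l ?exprn_ge0 // lerXn2r // nnegrE.
Qed.

Section Frame.
Local Open Scope sesquilinear_scope.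
Variable R : realType.
Local Notation C := R[i].
Local Notation "x %:C" := (real_complex R x).

Lemma ge0_ReK (z : C) : 0 <= z -> (complex.Re z)%:C = z.
Proof. by move=> z0; rewrite RRe_real // ger0_real. Qed.

Variables (N : nat) (pts : 'I_N -> C * C).
Hypothesis hinj : injective pts.
Hypothesis hmax : forall a b c : C, is_line a b ->
  (3 * #|[set i | on_line a b c (pts i)]| <= 2 * N)%N.
Hypothesis N_gt0 : (0 < N)%N.

Lemma exists_off_line (a b c : C) :
  is_line a b -> exists i, ~~ on_line a b c (pts i).
Proof.
move=> l; apply/existsP; rewrite -negb_forall; apply/negP => /forallP all_on.
have := hmax c l; rewrite (_ : [set i | _] = setT) ?cardsT ?card_ord; first by lia.
by apply/setP => i; rewrite !inE all_on.
Qed.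

(** A line through one point gives [3 <= 2 * N]; then a line through two points gives
    [6 <= 2 * N]. *)
Lemma three_points : (3 <= N)%N.
Proof.
have i0 : 'I_N := Ordinal N_gt0.
have card_ge2 (i j : 'I_N) : (3 * #|[set i; j]| <= 2 * N)%N.
  have [a [b [c [l oi oj]]]] := line_through (pts i) (pts j).
  apply: leq_trans (hmax c l); rewrite leq_mul2l /=.
  by apply/subset_leq_card/subsetP => k; rewrite !inE => /orP[] /eqP ->.
have := card_ge2 i0 i0; rewrite setUid cards1 => N2.
have [//|N3] := ltnP 2 N.
have lt1 : (1 < N)%N by lia.
by have := card_ge2 (Ordinal N_gt0) (Ordinal lt1); rewrite cards2 /=; lia.
Qed.

Let v i := homog (pts i).
Let Gram (x : 'I_N -> R) := wgram v setT (fun i => (x i)%:C).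
Let tau (x : 'I_N -> R) i :=
  x i * complex.Re (wform v (fun i => (x i)%:C) i i).
Let p (x : 'I_N -> R) := complex.Re (\det (Gram x)).

(* The greedy basis: the heaviest point, the heaviest other point, and the
   heaviest point off the line through these two. *)
Lemma Gram_lower_bound : exists2 c : R, 0 < c & forall x, (forall i, 0 < x i) ->
  posdef (Gram x) /\ c * (\prod_i x i) ^+ 3 <= p x ^+ N.
Proof.
pose D (f : {ffun 'I_3 -> 'I_N}) := complex.Re (`|\det (\matrix_k v (f k))| ^+ 2).
have DE f : (D f)%:C = `|\det (\matrix_k v (f k))| ^+ 2.
  by apply: ge0_ReK; rewrite exprn_ge0.
(* A minimum over the finitely many independent triples, hence independent of [x]; the default 1
   keeps it positive. *)
pose c := \big[Num.min/1]_(f | 0 < D f) D f.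
have c0 : 0 < c by apply: lt_bigmin.
exists (c ^+ N); first by rewrite exprn_gt0.
move=> x x0; have xC i : 0 < (x i)%:C by rewrite ltcR.
have N3 := three_points.
have := @arg_maxP _ R 'I_N (Ordinal N_gt0) xpredT x isT.
case=> a _ xa.
have [b0 b0a] : exists b, b != a.
  have lt1 : (1 < N)%N by apply: leq_trans N3.
  have [->|] := eqVneq a (Ordinal N_gt0); first by exists (Ordinal lt1).
  by exists (Ordinal N_gt0); rewrite eq_sym.
have := @arg_maxP _ R 'I_N b0 (fun i => i != a) x b0a.
case=> b ba xb.
have [la [lb [lc [l oa ob]]]] := line_through (pts a) (pts b).
have [c1 c1l] := exists_off_line lc l.
have := @arg_maxP _ R 'I_N c1 (fun i => ~~ on_line la lb lc (pts i)) x c1l.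
case=> e el xe.
have ea : e != a by apply: contraNneq el => ->.
have eb : e != b by apply: contraNneq el => ->.
pose f : {ffun 'I_3 -> 'I_N} := [ffun k => tnth [tuple a; b; e] k].
have fi : injective f.
  move=> k k'; rewrite !ffunE; apply/tuple_uniqP.
  by rewrite /= !inE !negb_or eq_sym ba eq_sym ea eq_sym eb.
have f0 : f 0 = a by rewrite ffunE.
have f1 : f 1 = b by rewrite ffunE.
have f2 : f 2%:R = e by rewrite ffunE.
have dV : \det (\matrix_k v (f k)) != 0.
  apply: homog_det_neq0 => a' b' c' l'.
  have [oa'|] := boolP (on_line a' b' c' (pts a)); last by exists 0; rewrite f0.
  have [ob'|] := boolP (on_line a' b' c' (pts b)); last by exists 1; rewrite f1.
  exists 2%:R; rewrite f2 -(line_unique _ _ l l' oa ob) //.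
  by rewrite (inj_eq hinj) eq_sym.
have [pG dG] := wgram_det_ge xC fi dV; split=> //.
have Df : 0 < D f by rewrite -ltcR DE exprn_gt0 // normr_gt0.
have cf : c <= D f by apply: bigmin_le_cond.
have pf : D f * (x a * x b * x e) <= p x.
  rewrite -lecR rmorphM /= DE ge0_ReK; last by have [_ _ /ltW] := pG.
  apply: le_trans dG; rewrite le_eqVlt; apply/orP; left; apply/eqP.
  congr (_ * _); rewrite !big_ord_recl big_ord0 mulr1 !rmorphM /= mulrA.
  congr (_%:C * _%:C * _%:C); congr (x _); rewrite -?f0 -?f1 -?f2;
    by congr (f _); apply/val_inj.
apply: (@le_trans _ _ ((D f * (x a * x b * x e)) ^+ N)).
  rewrite exprMn; apply: ler_pM.
  - by rewrite exprn_ge0 // ltW.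
  - by rewrite exprn_ge0 // prodr_ge0 // => i _; apply: ltW.
  - by rewrite lerXn2r // nnegrE ltW.
  have := @prod_le_top3 R 'I_N [set i | on_line la lb lc (pts i)] x a b e.
  rewrite card_ord; apply=> //; rewrite ?inE //; first exact: hmax.
  - by move=> i; apply: xa.
  - by move=> i; rewrite inE; apply: xe.
have Dx : 0 <= D f * (x a * x b * x e) by rewrite !mulr_ge0 // ltW.
by rewrite lerXn2r // nnegrE // (le_trans Dx).
Qed.

(** Changing one weight is a rank-one update, so the determinant is affine in that weight. *)
Lemma Gram_scale (x : 'I_N -> R) i h : posdef (Gram x) ->
  p (fun j => if j == i then (1 + h) * x j else x j) = p x * (1 + h * tau x i).
Proof.
move=> pG; have [_ _ dG] := pG.
have x'E : Gram (fun j => if j == i then (1 + h) * x j else x j) =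
    Gram x + ((h * x i)%:C *: (v i)^t*) *m v i.
  rewrite /Gram /wgram (bigD1 i) ?inE //= [in RHS](bigD1 i) ?inE //= eqxx.
  rewrite -scalemxAl addrAC -scalerDl mulrDl mul1r rmorphD /=; congr (_ + _).
  by apply: eq_bigr => j /andP[_ /negPf ->].
rewrite /p x'E det_rank1_update ?posdef_unit // -scalemxAr mxE.
rewrite -(ge0_ReK (ltW dG)) -[X in _ * (1 + _ * X)]ge0_ReK.
  by rewrite -rmorphM -(rmorph1 (real_complex R)) -rmorphD -rmorphM /= /tau mulrA.
exact: (wform_ge0 pG).
Qed.

(** The real data of the frame used for counting: [t] holds squared lengths, [g] squared moduli of
    inner products. The factor 2 is the dimension of the plane in C^3 over a line. *)
Lemma near_tight_frame (e : R) : 0 < e ->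
  exists (t : 'I_N -> R) (g : 'I_N -> 'I_N -> R),
  [/\ forall i, `|N%:R * t i - 3| <= e, \sum_i \sum_j g i j = 3,
      forall i, g i i = t i ^+ 2 &
      forall (A : {set 'I_N}) a b c, is_line a b ->
        {in A, forall i, on_line a b c (pts i)} ->
        (\sum_(i in A) t i) ^+ 2 <= 2 * \sum_(i in A) \sum_(j in A) g i j].
Proof.
move=> e0; have [c c0 Gc] := Gram_lower_bound.
have [||||x [x0 xe]] := near_critical (d := 3) (p := p) (tau := tau) c0 _ _ _ _ e0.
- by move=> x x0; have [[_ _ dG] _] := Gc x x0; rewrite -ltcR ge0_ReK // ltW.
- by move=> x x0; rewrite card_ord; have [] := Gc x x0.
- move=> x i x0; have [pG _] := Gc x x0.
  by rewrite mulr_ge0 ?(ltW (x0 i)) // -lecR ge0_ReK (wform_ge0 pG).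
- by move=> x i h x0 _; apply: Gram_scale; have [] := Gc x x0.
have [pG _] := Gc x x0; have xC i : 0 < (x i)%:C by rewrite ltcR.
pose G := wform v (fun i => (x i)%:C).
have G2 i j : (complex.Re (`|G i j| ^+ 2))%:C = `|G i j| ^+ 2.
  by rewrite ge0_ReK // exprn_ge0.
have G1 i : (complex.Re (G i i))%:C = G i i by rewrite ge0_ReK // (wform_ge0 pG).
pose g i j := x i * x j * complex.Re (`|G i j| ^+ 2).
have gC (A B : pred 'I_N) : (\sum_(i in A) \sum_(j in B) g i j)%:C =
    \sum_(i in A) \sum_(j in B) (x i)%:C * (x j)%:C * `|G i j| ^+ 2.
  rewrite rmorph_sum; apply: eq_bigr => i _; rewrite rmorph_sum.
  by apply: eq_bigr => j _; rewrite /g !rmorphM /= G2.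
exists (tau x), g; split.
- by move=> i; have := xe i; rewrite card_ord.
- apply: (fmorph_inj (real_complex R)); rewrite [LHS]gC rmorph_nat.
  exact: (sum_wform_sq pG).
- move=> i; apply: (fmorph_inj (real_complex R)); rewrite rmorphXn /g /tau !rmorphM /=.
  rewrite G2 -/(G i i) G1 ger0_norm ?(wform_ge0 pG) //; ring.
- move=> A a b c' l Al; have [k kl] := exists_off_line c' l.
  (* The normal of the plane over the line; the point [k] lies outside it. *)
  pose w : 'cV[C]_3 := \col_k [:: a; b; - c']`_k.
  have vw i : (v i *m w == 0) = on_line a b c' (pts i).
    rewrite /on_line -[RHS]subr_eq0.
    have -> : a * (pts i).1 + b * (pts i).2 - c' = (v i *m w) 0 0.
      by rewrite homog_mul !mxE.
    by apply/eqP/eqP => [-> | h]; [rewrite mxE | apply/matrixP => r s; rewrite !ord1 h mxE].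
  have Aw i : i \in A -> v i *m w = 0 by move=> iA; apply/eqP; rewrite vw Al.
  have kw : v k *m w != 0 by rewrite vw.
  have := hyperplane_trace xC pG isT Aw kw; rewrite -gC (eq_bigr (fun i => (tau x i)%:C)) => [|i _].
    by rewrite -rmorph_sum -rmorphXn -(rmorph_nat (real_complex R)) -rmorphM lecR.
  by rewrite /tau rmorphM /= -/(G i i) G1.
Qed.

End Frame.

(** * Counting pairs over lines and Langer's inequality *)

Lemma sum_blocks_pairs (V : zmodType) (I : finType) (L : {set {set I}})
    (g : I -> I -> V) :
  (forall i j, i != j -> #|[set S in L | (i \in S) && (j \in S)]| = 1%N) ->
  \sum_(S in L) \sum_(i in S) \sum_(j in S) g i j =
  \sum_i g i i *+ #|[set S in L | i \in S]| +
  (\sum_i \sum_j g i j - \sum_i g i i).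
Proof.
move=> L1.
(* Each ordered pair is weighted by the number of blocks containing both entries, which is 1 off the
   diagonal. *)
transitivity (\sum_i \sum_j g i j *+ #|[set S in L | (i \in S) && (j \in S)]|).
  transitivity (\sum_(S in L) \sum_i \sum_j
      (if (i \in S) && (j \in S) then g i j else 0)).
    apply: eq_bigr => S _; rewrite big_mkcond; apply: eq_bigr => i _.
    by case: ifP => _; [rewrite big_mkcond | rewrite big1].
  rewrite exchange_big; apply: eq_bigr => i _.
  rewrite exchange_big; apply: eq_bigr => j _.
  rewrite -big_mkcondr -sumr_const; apply: eq_bigl => S.
  by rewrite inE.
rewrite -sumrB -big_split; apply: eq_bigr => i _ /=.
rewrite (bigD1 i) //= [X in _ + (X - _)](bigD1 i) //= addrAC subrr add0r.
congr (_ *+ _ + _); first by apply: eq_card => S; rewrite !inE andbb.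
by apply: eq_bigr => j ji; rewrite L1 ?mulr1n // eq_sym.
Qed.

(** Lets the frame error tend to 0 in [langer]. *)
Lemma le0_of_small (R : realFieldType) (a b : R) :
  0 <= b -> (forall e, 0 < e -> e < 1 -> a <= e * b) -> a <= 0.
Proof.
move=> b0 H; rewrite leNgt; apply/negP => a0.
have ab0 : 0 < a + b + 1 by lra.
have := H (a / (a + b + 1)); rewrite divr_gt0 // ltr_pdivrMr // mul1r.
move=> /(_ isT); rewrite mulrAC ler_pdivlMr //; nra.
Qed.

Section Counting.
Variable R : realType.
Local Notation C := R[i].
Variables (N : nat) (pts : 'I_N -> C * C).
Hypothesis hinj : injective pts.
Hypothesis hmax : forall a b c : C, is_line a b ->
  (3 * #|[set i | on_line a b c (pts i)]| <= 2 * N)%N.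
Hypothesis N_gt0 : (0 < N)%N.

Definition spanned_lines : {set {set 'I_N}} :=
  [set S : {set 'I_N} | `[< line_section pts S >] && (2 <= #|S|)%N].

Lemma spanned_line_pair (i j : 'I_N) : i != j ->
  #|[set S in spanned_lines | (i \in S) && (j \in S)]| = 1%N.
Proof.
move=> ij; have [a [b [c [l oi oj]]]] := line_through (pts i) (pts j).
apply/eqP/cards1P; exists [set k | on_line a b c (pts k)].
apply/setP => S; rewrite !inE; apply/idP/eqP => [|->].
  move=> /andP[/andP[/asboolP[a' [b' [c' [l' Sl']]]] _]].
  rewrite !Sl' => /andP[oi' oj']; apply/setP => k; rewrite Sl' inE.
  by apply: (line_unique _ _ l' l oi' oj' oi oj); rewrite (inj_eq hinj).
rewrite !inE oi oj !andbT; apply/andP; split.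
  by apply/asboolP; exists a, b, c; split=> // k; rewrite inE.
by rewrite (cardsD1 i) (cardsD1 j) !inE oi oj eq_sym ij.
Qed.

Let L := spanned_lines.
Let deg i := #|[set S in L | i \in S]|.
Let P : nat := \sum_(S in L) #|S|.

Lemma sum_deg : \sum_i deg i = P.
Proof.
rewrite /P; under [RHS]eq_bigr => S _ do rewrite -sum1_card big_mkcond.
rewrite exchange_big; apply: eq_bigr => i _; rewrite /deg -sum1_card -big_mkcondr.
by apply: eq_bigl => S; rewrite inE.
Qed.

Lemma deg_gt0 i : (0 < deg i)%N.
Proof.
have N3 := three_points hmax N_gt0.
have [j ji] : exists j, i != j.
  have lt1 : (1 < N)%N by apply: leq_trans N3.
  have [->|] := eqVneq i (Ordinal N_gt0); first by exists (Ordinal lt1).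
  by exists (Ordinal N_gt0).
rewrite -(spanned_line_pair ji); apply/subset_leq_card/subsetP => S.
by rewrite !inE => /andP[-> /andP[-> _]].
Qed.

(** Pair counting for a product weight, used with the constant 1 and with the colour signs. *)
Lemma sum_line_sq (V : comNzRingType) (u : 'I_N -> V) :
  \sum_(S in L) (\sum_(i in S) u i) ^+ 2 =
  \sum_i u i ^+ 2 *+ deg i + ((\sum_i u i) ^+ 2 - \sum_i u i ^+ 2).
Proof.
rewrite expr2 big_distrlr /=.
rewrite -(@sum_blocks_pairs V _ L (fun i j => u i * u j)); last exact: spanned_line_pair.
by apply: eq_bigr => S _; rewrite expr2 big_distrlr.
Qed.

Lemma sum_line_card_sq : (\sum_(S in L) #|S| ^ 2 + N = P + N ^ 2)%N.
Proof.
have /= := @sum_line_sq int (fun=> 1).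
under eq_bigr => S _ do rewrite sumr_const.
rewrite expr1n !sumr_const card_ord => E; apply/eqP; rewrite -(eqr_nat int) !natrD.
rewrite -sum_deg !natr_sum natrX; under eq_bigr => S _ do rewrite natrX.
by rewrite E -addrA subrK.
Qed.

(* Langer's inequality [\sum |S| >= N (N + 3) / 3], in Bojanowski's form. *)
Lemma langer : (\sum_(S in L) #|S| ^ 2 + 4 * N <= 4 * P)%N.
Proof.
set Q := (\sum_(S in L) _)%N; have QP : (Q + N = P + N ^ 2)%N := sum_line_card_sq.
(* The frame estimate at [e = 0]; eliminating [N ^ 2] through [QP] turns it into three times the
   claim. *)
suff : (9 * Q%:R - 6 * N%:R ^+ 2 - 18 * (P%:R - N%:R) : R) <= 0.
  move=> H; have : ((9 * Q + 18 * N)%:R : R) <= (6 * N ^ 2 + 18 * P)%:R.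
    by rewrite !natrD !natrM; lra.
  by rewrite ler_nat; lia.
have NP : (N%:R : R) <= P%:R.
  rewrite ler_nat -sum_deg -[leqLHS]card_ord -sum1_card; apply: leq_sum => i _.
  exact: deg_gt0.
have Q0 : (0 : R) <= Q%:R by [].
(* The constants come from [9 - 6 * e <= (3 - e) ^+ 2] and twice [(3 + e) ^+ 2 <= 9 + 7 * e]. *)
apply: (@le0_of_small _ _ (6 * Q%:R + 14 * (P%:R - N%:R))) => [|e e0 e1].
  by lra.
have [t [g [te g3 gt tg]]] := near_tight_frame hinj hmax N_gt0 e0.
pose u i := N%:R * t i.
have u_lo i : 3 - e <= u i by have := te i; rewrite ler_norml /u => /andP[]; lra.
have u_hi i : u i <= 3 + e by have := te i; rewrite ler_norml /u => /andP[]; lra.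
have lower : (3 - e) ^+ 2 * Q%:R <= \sum_(S in L) (\sum_(i in S) u i) ^+ 2.
  rewrite natr_sum mulr_sumr; apply: ler_sum => S _; rewrite natrX -exprMn.
  rewrite lerXn2r ?nnegrE ?mulr_ge0 ?sumr_ge0 //; first by lra.
    by move=> i _; apply: le_trans (u_lo i); lra.
  by rewrite mulr_natr -sumr_const; apply: ler_sum.
(* The plane bound summed over lines. Degrees drop by one because the full double sum,
   [3 * N%:R ^+ 2], already contains the diagonal once. *)
have upper : \sum_(S in L) (\sum_(i in S) u i) ^+ 2 <=
    2 * (3 * N%:R ^+ 2 + \sum_i u i ^+ 2 *+ (deg i).-1).
  have -> : 3 * N%:R ^+ 2 + \sum_i u i ^+ 2 *+ (deg i).-1 =
      \sum_(S in L) \sum_(i in S) \sum_(j in S) N%:R ^+ 2 * g i j.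
    rewrite (@sum_blocks_pairs _ _ L (fun i j => N%:R ^+ 2 * g i j));
      last exact: spanned_line_pair.
    have gu i : N%:R ^+ 2 * g i i = u i ^+ 2 by rewrite gt exprMn.
    have -> : \sum_i \sum_j N%:R ^+ 2 * g i j = 3 * N%:R ^+ 2.
      by rewrite mulrC -g3 mulr_sumr; apply: eq_bigr => i _; rewrite mulr_sumr.
    have -> : \sum_i N%:R ^+ 2 * g i i *+ deg i =
        \sum_i u i ^+ 2 *+ (deg i).-1 + \sum_i N%:R ^+ 2 * g i i.
      rewrite -big_split; apply: eq_bigr => i _ /=.
      by rewrite gu -mulrSr prednK // deg_gt0.
    by ring.
  rewrite mulr_sumr; apply: ler_sum => S.
  rewrite inE => /andP[/asboolP[a [b [c [l Sl]]]] _].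
  have Sline : {in S, forall i, on_line a b c (pts i)} by move=> i; rewrite Sl.
  have := ler_wpM2l (sqr_ge0 (N%:R : R)) (tg S a b c l Sline).
  rewrite -exprMn mulr_sumr mulrCA mulr_sumr; congr (_ <= _ * _).
  by apply: eq_bigr => i _; rewrite mulr_sumr.
have deg_sum : \sum_i u i ^+ 2 *+ (deg i).-1 <= (3 + e) ^+ 2 * (P%:R - N%:R).
  rewrite -natrB; last by rewrite -(ler_nat R).
  have -> : (P - N = \sum_i (deg i).-1)%N.
    rewrite -sum_deg -[X in (_ - X)%N]card_ord -sum1_card -sumnB => [|i _].
      by apply: eq_bigr => i _; rewrite subn1.
    exact: deg_gt0.
  rewrite natr_sum mulr_sumr; apply: ler_sum => i _.
  rewrite mulr_natr lerMn2r; apply/orP; right.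
  by rewrite lerXn2r ?nnegrE //; [apply: le_trans (u_lo i); lra | lra].
have e2 : e ^+ 2 <= e by rewrite expr2 ler_piMl ?ltW.
have a1 : (9 - 6 * e) * Q%:R <= (3 - e) ^+ 2 * Q%:R.
  by rewrite ler_wpM2r //; have := sqr_ge0 e; nra.
have a2 : (3 + e) ^+ 2 * (P%:R - N%:R) <= (9 + 7 * e) * (P%:R - N%:R).
  by rewrite ler_wpM2r ?subr_ge0 //; nra.
by lra.
Qed.

End Counting.

(** * Colours and the final count *)

Lemma equichromatic_weight (i j : nat) : (2 <= i + j)%N ->
  5 * (i + j)%:Z - ((i + j) ^ 2)%N%:Z - (i%:Z - j%:Z) ^+ 2 <=
  6 * ((`|(i%:Z - j%:Z)%R|%N <= 2)%N && (i + j <= 4)%N)%:R.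
Proof.
(* For s = i + j, 5s - s^2 is 6, 6, 4 at s = 2, 3, 4 and nonpositive from 5 on; a colour difference
   of at least 3 subtracts 9 or more. *)
move=> ij2; rewrite -mulnn expr2.
by case: (boolP (_ && _)) => /= H; nia.
Qed.

Section Coloured.
Variable R : realType.
Local Notation C := R[i].
Variables (N : nat) (pts : 'I_N -> C * C) (green : {set 'I_N}).
Hypothesis hinj : injective pts.
Hypothesis hmax : forall a b c : C, is_line a b ->
  (3 * #|[set i | on_line a b c (pts i)]| <= 2 * N)%N.
Hypothesis N_gt0 : (0 < N)%N.

Lemma count_2eq_small_lines_ge :
  5 * N%:Z - (#|green|%:Z - #|~: green|%:Z) ^+ 2 <=
  6 * (count_2eq_small_lines pts green)%:Z.
Proof.
pose L := spanned_lines pts; pose P := (\sum_(S in L) #|S|)%N.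
pose col i : int := if i \in green then 1 else -1.
have colE (S : {set 'I_N}) :
    \sum_(i in S) col i = #|S :&: green|%:Z - #|S :\: green|%:Z.
  rewrite (bigID (mem green)) /=; congr (_ + _).
    rewrite (eq_bigr (fun=> 1)) => [|i /andP[_ ig]]; last by rewrite /col ig.
    by rewrite -natz -sumr_const; apply: eq_bigl => i; rewrite inE.
  rewrite (eq_bigr (fun=> -1)) => [|i /andP[_ /negPf ig]]; last by rewrite /col ig.
  by rewrite sumrN -natz -sumr_const; congr (- _); apply: eq_bigl => i; rewrite inE andbC.
have col2 i : col i ^+ 2 = 1 by rewrite /col; case: ifP.
(* The signs [col] have square 1, so the diagonal terms of [sum_line_sq] contribute [P - N]. *)
have colour : \sum_(S in L) (#|S :&: green|%:Z - #|S :\: green|%:Z) ^+ 2 =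
    P%:Z + (#|green|%:Z - #|~: green|%:Z) ^+ 2 - N%:Z.
  under eq_bigr => S _ do rewrite -colE.
  rewrite (sum_line_sq hinj).
  have -> : \sum_i col i = #|green|%:Z - #|~: green|%:Z.
    have := colE setT; rewrite setTI setTD => <-.
    by apply: eq_bigl => i; rewrite inE.
  under [X in X + _]eq_bigr => i _ do rewrite col2.
  rewrite -natr_sum sum_deg natz addrA; congr (_ - _).
  by under eq_bigr => i _ do rewrite col2; rewrite sumr_const card_ord natz.
have count : \sum_(S in L) (5 * #|S|%:Z - (#|S| ^ 2)%N%:Z -
    (#|S :&: green|%:Z - #|S :\: green|%:Z) ^+ 2) <=
    6 * (count_2eq_small_lines pts green)%:Z.
  have -> : (count_2eq_small_lines pts green)%:Z = \sum_(S in L)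
      ((`|(#|S :&: green|%:Z - #|S :\: green|%:Z)%R|%N <= 2)%N && (#|S| <= 4)%N)%:R.
    rewrite -natr_sum natz; congr Posz; rewrite /count_2eq_small_lines -sum1_card.
    rewrite big_mkcond [RHS]big_mkcond; apply: eq_bigr => S _.
    rewrite !inE /r_equichromatic cardsID; 
    by case: `[< _ >]; case: (1 < #|S|)%N; case: (absz _ <= 2)%N; case: (_ <= 4)%N.
  rewrite mulr_sumr; apply: ler_sum => S; rewrite inE => /andP[_ S2].
  have := @equichromatic_weight #|S :&: green| #|S :\: green|.
  by rewrite cardsID; apply.
(* The total weight is [4 * P] minus the sum of squared line sizes, plus [N], minus the squared
   colour difference; [langer] bounds the first two terms below by [4 * N]. *)
apply: le_trans count; rewrite !sumrB colour -mulr_sumr.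
have := langer hinj hmax N_gt0.
rewrite -/L -/P => la.
have -> : \sum_(S in L) #|S|%:Z = P%:Z by rewrite -natz natr_sum; apply: eq_bigr => S _; rewrite natz.
have -> : \sum_(S in L) (#|S| ^ 2)%N%:Z = (\sum_(S in L) #|S| ^ 2)%N%:Z.
  by rewrite -natz natr_sum; apply: eq_bigr => S _; rewrite natz.
by lia.
Qed.

End Coloured.

Theorem theorem3p2 (R : realType) (n k : nat) (hk : (k <= n)%N)
    (pts : 'I_(2 * n - k) -> R[i] * R[i]) (green : {set 'I_(2 * n - k)})
    (hinj : injective pts) (hgreen : #|green| = n)
    (hmax : forall a b c : R[i], is_line a b ->
       (3 * #|[set i | on_line a b c (pts i)]| <= 2 * (2 * n - k))%N) :
  (10 * n)%:Z - (k * (k + 5))%:Z <= (6 * count_2eq_small_lines pts green)%:Z.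
Proof.
(* Without points, [n] and [k] are both 0 and so is the bound. *)
have [N0|N_gt0] := posnP (2 * n - k).
  have n0 : n = 0%N by lia.
  by nia.
have := count_2eq_small_lines_ge green hinj hmax N_gt0.
have -> : #|~: green| = (n - k)%N by rewrite cardsCs setCK hgreen card_ord; lia.
(* The colour difference is [k], and 5(2n - k) - k^2 = 10n - k(k + 5). *)
rewrite hgreen; nia.
Qed.
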